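(* Let $a<b<c$ be real numbers and let $m,n\ge1$ be integers. Let $P_i=(x_i^-,y_i^-)\in(a,b)\times(0,1)$, $i=1,\dots,m$, satisfy $a<x_1^-<\cdots<x_m^-<b$ and $0<y_1^-<\cdots<y_m^-<1$, and let $Q_j=(x_j^+,y_j^+)\in(b,c)\times(0,1)$, $j=1,\dots,n$, satisfy $b<x_1^+<\cdots<x_n^+<c$ and $0<y_n^+<\cdots<y_1^+<1$. Then there exists at least one pair $(h,p)$, with $h\in H([0,1])$ and $p=(p^-,p^+)$ a pair of probability density functions, such that the graph of the membership function $f_{h,p}$ with parameters $a,b,c$ passes through all the points $P_i$ and $Q_j$, i.e. $f_{h,p}(x_i^-)=y_i^-$ for $i=1,\dots,m$ and $f_{h,p}(x_j^+)=y_j^+$ for $j=1,\dots,n$.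
   Context: A left auxiliary function (LAF) on $[0,1]$ is a function $h:(0,1)\to\mathbb{R}$ which is continuous and increasing on $(0,1)$ with $\lim_{x\to0^+}h(x)=-\infty$ and $\lim_{x\to1^-}h(x)=+\infty$. $H([0,1])$ denotes the set of all LAFs on $[0,1]$. A function $q:\mathbb{R}\to\mathbb{R}$ is a probability density function (PDF) if $q(t)\ge0$ for all $t\in\mathbb{R}$ and $\int_{-\infty}^{+\infty}q(y)\,dy=1$. Given $h\in H([0,1])$, a pair $p=(p^-,p^+)$ of PDFs and reals $a<b<c$, put $h^-(x)=h\left(\frac{x-a}{b-a}\right)$ for $x\in(a,b)$ and $h^+(x)=h\left(\frac{c-x}{c-b}\right)$ for $x\in(b,c)$. The membership function $f_{h,p}:\mathbb{R}\to[0,1]$ with parameters $a,b,c$ is defined by $f_{h,p}(x)=0$ for $x\in(-\infty,a]\cup[c,+\infty)$; $f_{h,p}(x)=\int_{-\infty}^{h^-(x)}p^-(y)\,dy$ for $x\in(a,b)$; $f_{h,p}(b)=1$; and $f_{h,p}(x)=\int_{-\infty}^{h^+(x)}p^+(y)\,dy$ for $x\in(b,c)$. *)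

(* Defs.v *)
From HB Require Import structures.
From mathcomp Require Import all_boot all_order all_algebra.
From mathcomp Require Import all_classical all_reals all_analysis.

Set Implicit Arguments.
Unset Strict Implicit.
Unset Printing Implicit Defensive.

Import Order.TTheory GRing.Theory Num.Theory.
Import numFieldNormedType.Exports.

Local Open Scope classical_set_scope.
Local Open Scope ring_scope.

(* A function on the open interval (0, 1) is represented by a total function
   whose values outside the interval are irrelevant. "Increasing" is read
   strictly. *)
Definition LAF01 (R : realType) : set (R -> R) :=
  [set h : R -> R |
    [/\ {in `]0, 1[, continuous h},
        {in `]0, 1[ &, {homo h : x y / x < y}},
        h x @[x --> 0^'+] --> -oo &
        h x @[x --> 1^'-] --> +oo]].

(* Measurability is implicit in the existence of the integral of q; it is
   required here because the library's integral is defined for every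
   function. *)
Definition is_pdf (R : realType) (q : R -> R) : Prop :=
  [/\ measurable_fun [set: R] q,
      forall t : R, 0 <= q t &
      (\int[lebesgue_measure]_(y in [set: R]) (q y)%:E = 1)%E].

Definition membership (R : realType) (h : R -> R) (p : (R -> R) * (R -> R))
    (a b c x : R) : R :=
  if (x <= a) || (c <= x) then 0
  else if x < b then
    \int[lebesgue_measure]_(y in `]-oo, h ((x - a) / (b - a))]) p.1 y
  else if x == b then 1
  else \int[lebesgue_measure]_(y in `]-oo, h ((c - x) / (c - b))]) p.2 y.

Lemma pdf_Rintegral_itv (R : realType) (q : R -> R) (t : R) : is_pdf q ->
  0 <= \int[lebesgue_measure]_(y in `]-oo, t]) q y <= 1.
Proof.
move=> [mq q0 q1].
have i0 : (0 <= \int[lebesgue_measure]_(y in `]-oo, t]) (q y)%:E)%E.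
  by apply: integral_ge0 => y _; rewrite lee_fin.
have i1 : (\int[lebesgue_measure]_(y in `]-oo, t]) (q y)%:E <= 1)%E.
  rewrite -q1; apply: ge0_subset_integral => //.
  - exact/measurable_realfun.measurable_EFinP.
  - by move=> y _; rewrite lee_fin.
rewrite /Rintegral fine_ge0//= -lee_fin fineK// ge0_fin_numE//.
exact: le_lt_trans i1 (ltry _).
Qed.

Lemma membership_itv (R : realType) (h : R -> R) (p : (R -> R) * (R -> R))
  (a b c x : R) : is_pdf p.1 -> is_pdf p.2 -> 0 <= membership h p a b c x <= 1.
Proof.
move=> p1 p2; rewrite /membership.
case: ifP => _; first by rewrite lexx ler01.
case: ifP => _; first exact: pdf_Rintegral_itv.
case: ifP => _; first by rewrite lexx ler01.
exact: pdf_Rintegral_itv.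
Qed.

(* Main.v *)
(* Any LAF will do, for instance the logit x |-> ln x - ln (1 - x): an increasing
   h turns the abscissae into increasing levels t_1 < ... < t_m (on the right-hand
   side of b, after reversing the order of the points), and it remains to find a
   density whose distribution function takes the value y_i at t_i. With
   y_0 = 0, y_(m+1) = 1, t_0 < t_1 and t_(m+1) > t_m, the mixture of the uniform
   densities on the intervals [t_k, t_(k+1)] with weights y_(k+1) - y_k is one. *)
Require Import Defs.
From HB Require Import structures.
From mathcomp Require Import all_boot all_order all_algebra.
From mathcomp Require Import all_classical all_reals all_analysis.
From mathcomp Require Import measurable_realfun.

Import Order.TTheory GRing.Theory Num.Theory.
Import numFieldNormedType.Exports.

Local Open Scope classical_set_scope.
Local Open Scope ring_scope.

(** After exponentiation the bound on [x / (1 - x)] becomes linear in [x]. The threshold is the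
    logistic function at [A]; since it lies strictly between 0 and 1, this bound and the reverse one
    below give the two endpoint limits of the logit. *)
Lemma logit_le (R : realType) (A x : R) : 0 < x < 1 ->
  (ln x - ln (1 - x) <= A) = (x <= expR A / (1 + expR A)).
Proof.
move=> /andP[x0 x1]; have y0 : 0 < 1 - x by rewrite subr_gt0.
rewrite -ln_div ?posrE// -{1}[A]expRK ler_ln ?posrE ?divr_gt0 ?expR_gt0//.
rewrite ler_pdivrMr// ler_pdivlMr ?addr_gt0 ?expR_gt0//.
by rewrite mulrBr mulrDr !mulr1 lerBrDr [expR A * x]mulrC.
Qed.

Lemma logit_ge (R : realType) (A x : R) : 0 < x < 1 ->
  (A <= ln x - ln (1 - x)) = (expR A / (1 + expR A) <= x).
Proof.
move=> /andP[x0 x1]; have y0 : 0 < 1 - x by rewrite subr_gt0.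
rewrite -ln_div ?posrE// -{1}[A]expRK ler_ln ?posrE ?divr_gt0 ?expR_gt0//.
rewrite ler_pdivlMr// ler_pdivrMr ?addr_gt0 ?expR_gt0//.
by rewrite mulrBr mulrDr !mulr1 lerBlDr [expR A * x]mulrC.
Qed.

Lemma LAF01_logit (R : realType) : LAF01 (fun x : R => ln x - ln (1 - x)).
Proof.
split.
- move=> x; rewrite in_itv/= => /andP[x0 x1].
  apply: cvgB; first exact: continuous_ln.
  apply: (continuous_comp (f := fun x : R => 1 - x)).
    by apply: cvgB; [exact: cvg_cst|exact: cvg_id].
  by apply: continuous_ln; rewrite subr_gt0.
- move=> x y; rewrite !in_itv/= => /andP[x0 x1] /andP[y0 y1] xy.
  by rewrite ltrB ?ltr_ln ?posrE ?subr_gt0// ltrD2l ltrN2.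
- apply/cvgrNyPle => A; near=> x.
  have x0 : 0 < x by [].
  have x1 : x < 1 by near: x; exact: nbhs_right_lt.
  rewrite logit_le ?x0//; apply: ltW; near: x; apply: nbhs_right_lt.
  by rewrite divr_gt0 ?addr_gt0 ?expR_gt0.
- apply/cvgryPge => A; near=> x.
  have x0 : 0 < x by near: x; exact: nbhs_left_gt.
  have x1 : x < 1 by [].
  rewrite logit_ge ?x0//; apply: ltW; near: x.
  by apply: nbhs_left_gt; rewrite ltr_pdivrMr ?addr_gt0 ?expR_gt0// mul1r ltrDr.
Unshelve. all: by end_near.
Qed.

Lemma integral_uniform_pdf0 (R : realType) (a b t : R) : t <= a ->
  (\int[lebesgue_measure]_(x in `]-oo, t]) (uniform_pdf a b x)%:E = 0)%E.
Proof.
move=> ta; rewrite integral_uniform_pdf; apply: null_set_integral => //.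
- exact: measurableI.
- apply/measurable_EFinP/measurable_funTS; exact: measurable_uniform_pdf.
- apply: (@subset_measure0 _ _ _ lebesgue_measure _ [set a]) => //.
  + exact: measurableI.
  + move=> x [] /=; rewrite !in_itv/= => xt /andP[ax _].
    by apply/eqP; rewrite eq_le ax (le_trans xt ta).
  + exact: lebesgue_measure_set1.
Qed.

(** Nonnegative terms let sum and integral commute. The domain [D] is arbitrary so as to serve both
    the total mass and the values of the distribution function. *)
Lemma integral_uniform_mixture (R : realType) (N : nat) (T w : nat -> R)
    (D : set R) : measurable D ->
  (forall k, T k < T k.+1) -> (forall k, 0 <= w k) ->
  (\int[lebesgue_measure]_(x in D)
     (\sum_(k < N) w k * uniform_pdf (T k) (T k.+1) x)%:E =
   \sum_(k < N) (w k)%:E *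
     \int[lebesgue_measure]_(x in D) (uniform_pdf (T k) (T k.+1) x)%:E)%E.
Proof.
move=> mD Tlt w0.
have mu (k : 'I_N) : measurable_fun D (fun x => (uniform_pdf (T k) (T k.+1) x)%:E).
  by apply/measurable_EFinP/measurable_funTS; exact: measurable_uniform_pdf.
have u0 (k : 'I_N) x : D x -> (0 <= (uniform_pdf (T k) (T k.+1) x)%:E)%E.
  by move=> _; rewrite lee_fin uniform_pdf_ge0.
under eq_integral do rewrite -sumEFin.
rewrite ge0_integral_sum//.
- apply: eq_bigr => k _; rewrite -ge0_integralZl_EFin//; first exact: u0.
  exact: mu.
- move=> k; apply/measurable_EFinP/measurable_funM => //.
  by apply: measurable_funTS; exact: measurable_uniform_pdf.
- by move=> k x Dx; rewrite lee_fin mulr_ge0// uniform_pdf_ge0.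
Qed.

(** Below [T i], the pieces with [k < i] contribute their full weight and the others nothing, so the
    weights telescope to [Y i]. Nodes are indexed by [nat] to avoid ordinal arithmetic; [Y] may be
    constant, as it will be past the last node. *)
Lemma pdf_interpolation_nat (R : realType) (N : nat) (T Y : nat -> R) :
  (forall k, T k < T k.+1) -> (forall k, Y k <= Y k.+1) ->
  Y 0%N = 0 -> Y N = 1 ->
  exists2 q : R -> R, is_pdf q & forall i, (i <= N)%N ->
    \int[lebesgue_measure]_(y in `]-oo, T i]) q y = Y i.
Proof.
move=> Tlt Yle Y0 YN.
have Tmono : {homo T : i j / (i <= j)%N >-> i <= j}.
  by apply/nondecreasing_seqP => k; exact: ltW.
have w0 k : 0 <= Y k.+1 - Y k by rewrite subr_ge0.
have Ysum i : \sum_(k < i) (Y k.+1 - Y k) = Y i.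
  by rewrite -(big_mkord xpredT (fun k => Y k.+1 - Y k)) telescope_sumr// Y0 subr0.
exists (fun x => \sum_(k < N) (Y k.+1 - Y k) * uniform_pdf (T k) (T k.+1) x).
  split.
  - apply: measurable_sum => k; apply: measurable_funM => //.
    exact: measurable_uniform_pdf.
  - by move=> x; apply: sumr_ge0 => k _; rewrite mulr_ge0// uniform_pdf_ge0.
  - rewrite (integral_uniform_mixture _ _ _ (fun k => Y k.+1 - Y k))//.
    under eq_bigr do rewrite integral_uniform_pdf1// mule1.
    by rewrite sumEFin Ysum YN.
move=> i iN; rewrite /Rintegral.
rewrite (integral_uniform_mixture _ _ _ (fun k => Y k.+1 - Y k))//.
(* The [i] increments summing to [Y i] are padded with zeros to [N] terms, to be compared one by one
   with those of the mixture. *)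
rewrite -[RHS]Ysum (big_ord_widen_cond N xpredT (fun k => Y k.+1 - Y k))//.
rewrite [RHS]big_mkcond/= (eq_bigr (fun k : 'I_N =>
  (if (k < i)%N then Y k.+1 - Y k else 0)%:E)) ?sumEFin// => k _.
case: ltnP => [ki|ik].
- rewrite integral_uniform_pdf1 ?mule1// => x /=.
  by rewrite !in_itv/= => /andP[_ /le_trans]; apply; exact: Tmono.
- by rewrite integral_uniform_pdf0 ?mule0//; exact: Tmono.
Qed.

Lemma pdf_interpolation (R : realType) (m : nat) (t y : 'I_m -> R) :
  (0 < m)%N ->
  (forall i j : 'I_m, (i < j)%N -> t i < t j) ->
  (forall i j : 'I_m, (i < j)%N -> y i < y j) ->
  (forall i, 0 < y i < 1) ->
  exists2 q : R -> R, is_pdf q &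
    forall i, \int[lebesgue_measure]_(x in `]-oo, t i]) q x = y i.
Proof.
case: m t y => [//|m] t y _ tlt ylt y01.
(* Indices shift by one: node 0 is the added left end and node [i.+1] carries the data of index [i].
   Past the data, [T] keeps growing by unit steps and [Y] stays at 1. *)
pose T k := if k is k'.+1 then
  if insub k' is Some i then t i else t ord_max + k%:R else t ord0 - 1.
pose Y k := if k is k'.+1 then if insub k' is Some i then y i else 1 else 0.
(* There are now [m.+1] data points; with the two added ends they bound [m.+2] intervals. *)
have [||//||q pq qY] := @pdf_interpolation_nat R m.+2 T Y.
- case=> [|k] /=.
    by case: insubP => //= i _ i0; rewrite (_ : i = ord0) ?gtrBl//; exact/val_inj.
  case: insubP => [i im ik|]; case: insubP => [j jm jk|].
  + by apply: tlt; rewrite ik jk.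
  + move=> _; apply: (@le_lt_trans _ _ (t ord_max)); last by rewrite ltrDl.
    have := leq_ord i; rewrite leq_eqVlt => /orP[/eqP im'|im']; last exact/ltW/tlt.
    by rewrite (_ : i = ord_max)//; exact/val_inj.
  + by move=> /negP; case; exact: ltnW.
  + by rewrite ltrD2l ltr_nat.
- case=> [|k] /=.
    by case: insubP => //= i _ _; have /andP[/ltW] := y01 i.
  case: insubP => [i im ik|]; case: insubP => [j jm jk|] => //.
  + by apply/ltW/ylt; rewrite ik jk.
  + by have /andP[_ /ltW] := y01 i.
  + by move=> /negP; case; exact: ltnW.
- by rewrite /Y insubF// ltnn.
exists q => // i.
have := qY i.+1; rewrite /T /Y.
case: insubP => [j _ /val_inj ->|/negP[]//]; apply.
exact/leqW/ltn_ord.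
Qed.

Theorem theorem3p2 (R : realType) (a b c : R) (hab : a < b) (hbc : b < c)
    (m n : nat) (hm : (1 <= m)%N) (hn : (1 <= n)%N)
    (xm ym : 'I_m -> R) (xp yp : 'I_n -> R)
    (hxm : forall i, a < xm i < b)
    (hym : forall i, 0 < ym i < 1)
    (hxm_incr : forall i j : 'I_m, (i < j)%N -> xm i < xm j)
    (hym_incr : forall i j : 'I_m, (i < j)%N -> ym i < ym j)
    (hxp : forall j, b < xp j < c)
    (hyp : forall j, 0 < yp j < 1)
    (hxp_incr : forall i j : 'I_n, (i < j)%N -> xp i < xp j)
    (hyp_decr : forall i j : 'I_n, (i < j)%N -> yp j < yp i) :
  exists (h : R -> R) (p : (R -> R) * (R -> R)),
    [/\ LAF01 h, is_pdf p.1, is_pdf p.2,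
        forall i, membership h p a b c (xm i) = ym i &
        forall j, membership h p a b c (xp j) = yp j].
Proof.
have itvm i : (xm i - a) / (b - a) \in `]0, 1[.
  have /andP[ax xb] := hxm i.
  by rewrite in_itv/= divr_gt0 ?subr_gt0//= ltr_pdivrMr ?subr_gt0// mul1r ltrD2r.
have itvp j : (c - xp j) / (c - b) \in `]0, 1[.
  have /andP[bx xc] := hxp j.
  by rewrite in_itv/= divr_gt0 ?subr_gt0//= ltr_pdivrMr ?subr_gt0// mul1r ltrD2l ltrN2.
pose h (x : R) := ln x - ln (1 - x).
have hLAF : LAF01 h := LAF01_logit R; have [_ hlt _ _] := hLAF.
have [//|i j ij|//|//|pm pmpdf pmE] :=
    @pdf_interpolation R m (fun i => h ((xm i - a) / (b - a))) ym.
  apply: hlt => //; rewrite ltr_pM2r ?invr_gt0 ?subr_gt0// ltrD2r.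
  exact: hxm_incr.
(* Right of [b], both [(c - x) / (c - b)] and the ordinates decrease along the points; [rev_ord]
   makes both sequences increasing. *)
have rev_lt (i j : 'I_n) : (i < j)%N -> (rev_ord j < rev_ord i)%N.
  by move=> ij; rewrite /= ltn_sub2l// (leq_ltn_trans ij).
have [//|i j /rev_lt ij|i j /rev_lt/hyp_decr//|//|pp pppdf ppE] :=
    @pdf_interpolation R n (fun j => h ((c - xp (rev_ord j)) / (c - b)))
      (fun j => yp (rev_ord j)).
  apply: hlt => //; rewrite ltr_pM2r ?invr_gt0 ?subr_gt0// ltrD2l ltrN2.
  exact: hxp_incr.
exists h, (pm, pp); split => //=.
- move=> i; have /andP[ax xb] := hxm i.
  by rewrite /membership leNgt ax leNgt (lt_trans xb hbc)/= xb pmE.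
- move=> j; have /andP[bx xc] := hxp j.
  rewrite /membership leNgt (lt_trans hab bx) leNgt xc/= ltNge (ltW bx)/= gt_eqF//.
  by have := ppE (rev_ord j); rewrite /= rev_ordK.
Qed.
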